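(* Let $$\cdots\xrightarrow{\pi_3}G_2\xrightarrow{\pi_2}G_1\xrightarrow{\pi_1}G_0=G$$ be a sequence of fundamental epimorphisms of profinite groups. Let $H=\varprojlim_iG_i$ with projections $\rho_i\colon H\twoheadrightarrow G_i$ (so $\rho_{i-1}=\pi_i\circ\rho_i$ for $i\ge1$), put $\pi=\rho_0\colon H\twoheadrightarrow G$, and for $\ell>k$ put $\pi_{\ell,k}=\pi_{k+1}\circ\cdots\circ\pi_\ell\colon G_\ell\twoheadrightarrow G_k$. The following are equivalent: (a) For no $k\ge1$ are there epimorphisms $\sigma\colon H\twoheadrightarrow H_{k-1}$ and $\eta_{k-1}\colon H_{k-1}\twoheadrightarrow G_{k-1}$ with $\eta_{k-1}$ indecomposable and $\eta_{k-1}\circ\sigma=\pi_k\circ\rho_k=\rho_{k-1}$ such that the square formed by $\rho_k,\pi_k,\sigma,\eta_{k-1}$ is semi-cartesian. (b) For no $\ell\ge k\ge1$ are there epimorphisms $\sigma\colon H\twoheadrightarrow H_{k-1}$ and $\eta_{k-1}\colon H_{k-1}\twoheadrightarrow G_{k-1}$ with $\eta_{k-1}$ indecomposable and $\eta_{k-1}\circ\sigma=\pi_{\ell,k-1}\circ\rho_\ell=\rho_{k-1}$ such that the square formed by $\rho_\ell,\pi_{\ell,k-1},\sigma,\eta_{k-1}$ is semi-cartesian. (c) For no $k\ge1$ are there epimorphisms $\tau\colon G_{k+1}\twoheadrightarrow H_{k-1}$ and $\eta_{k-1}\colon H_{k-1}\twoheadrightarrow G_{k-1}$ with $\eta_{k-1}$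 indecomposable and $\eta_{k-1}\circ\tau=\pi_k\circ\pi_{k+1}$ such that the square formed by $\pi_{k+1},\pi_k,\tau,\eta_{k-1}$ is semi-cartesian. (d) The given sequence is the fundament series of $\pi$ (i.e. $\operatorname{Ker}\rho_k=M_k(\pi)$ for every $k\ge0$).
   Context: All groups are profinite, homomorphisms are continuous, subgroups are closed; $\twoheadrightarrow$ denotes an epimorphism. An epimorphism is indecomposable if it is not an isomorphism and is not a composition of two epimorphisms neither of which is an isomorphism. For $M\triangleleft H$, $\mathcal{N}_M(H)$ is the set of maximal elements among the normal subgroups of $H$ strictly contained in $M$. The fundament kernel of an epimorphism $\pi\colon H\twoheadrightarrow G$ is $\mathcal{M}(\pi)=\bigcap_{N\in\mathcal{N}_{\operatorname{Ker}\pi}(H)}N$ (understood as $\operatorname{Ker}\pi$ if $\operatorname{Ker}\pi=1$); $\pi$ is fundamental if $\mathcal{M}(\pi)=1$. The fundament kernel series of $\pi$ is given by $M_0(\pi)=\operatorname{Ker}\pi$ and $M_i(\pi)=\bigcap_{N\in\mathcal{N}_{M_{i-1}(\pi)}(H)}N$ for $i\ge1$ (same convention), and its fundament series is the sequence of quotient maps $\cdots\to H/M_2(\pi)\to H/M_1(\pi)\to H/M_0(\pi)=G$. A commutative square of epimorphisms $\eta\colon P\twoheadrightarrow Q$, $\beta\colon P\twoheadrightarrow B$, $\alpha\colon B\twoheadrightarrow A$, $\varphi\colon Q\twoheadrightarrow A$ with $\alpha\circ\beta=\varphi\circ\eta$ is semi-cartesian if $\eta(\operatorname{Ker}\beta)=\operatorname{Ker}\varphi$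 (equivalently, $\beta(\operatorname{Ker}\eta)=\operatorname{Ker}\alpha$). *)

(* Defs.v *)
From HB Require Import structures.
From mathcomp Require Import all_boot.
From mathcomp Require Import boolp classical_sets functions topology.

Set Implicit Arguments.
Unset Strict Implicit.
Unset Printing Implicit Defensive.

Local Open Scope classical_set_scope.
Local Open Scope group_scope.

HB.mixin Record isTopologicalGroup G of Group G & Topological G := {
  mulg_continuous : continuous (fun x : G * G => x.1 * x.2);
  invg_continuous : continuous (fun x : G => x^-1)
}.

#[short(type="topologicalGroupType")]
HB.structure Definition TopologicalGroup :=
  {G of isTopologicalGroup G & Group G & Topological G}.

HB.mixin Record TopologicalGroup_isProfinite G of TopologicalGroup G := {
  profinite_compact : compact [set: G];
  profinite_hausdorff : hausdorff_space G;
  profinite_totally_disconnected : totally_disconnected [set: G]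
}.

#[short(type="profiniteGroupType")]
HB.structure Definition ProfiniteGroup :=
  {G of TopologicalGroup_isProfinite G & TopologicalGroup G}.

Definition homomorphism (A B : profiniteGroupType) (f : A -> B) : Prop :=
  continuous f /\ {morph f : x y / x * y >-> x * y}.

Definition epimorphism (A B : profiniteGroupType) (f : A -> B) : Prop :=
  homomorphism f /\ set_surj [set: A] [set: B] f.

Definition isomorphism (A B : profiniteGroupType) (f : A -> B) : Prop :=
  homomorphism f /\
  exists g : B -> A, [/\ homomorphism g, cancel f g & cancel g f].

Definition kernel (A B : profiniteGroupType) (f : A -> B) : set A :=
  f @^-1` [set 1].

(* To be used for epimorphisms f. *)
Definition indecomposable (A B : profiniteGroupType) (f : A -> B) : Prop :=
  ~ isomorphism f /\
  ~ exists (C : profiniteGroupType) (g : A -> C) (h : C -> B),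
      [/\ epimorphism g, epimorphism h, ~ isomorphism g, ~ isomorphism h
        & f =1 h \o g].

(* Subgroups of profinite groups are closed by convention. *)
Record normal_subgroup (H : profiniteGroupType) (N : set H) : Prop := {
  normal_closed : closed N;
  normal1 : N 1;
  normalM : forall x y, N x -> N y -> N (x * y);
  normalV : forall x, N x -> N x^-1;
  normalJ : forall x y, N x -> N (x ^ y)
}.

Definition maximal_normal (H : profiniteGroupType) (M : set H) :
    set (set H) :=
  [set N | [/\ normal_subgroup N, N `<` M
     & forall N' : set H,
         normal_subgroup N' -> N' `<` M -> N `<=` N' -> N' = N]].

(* The intersection is taken inside M, so that an empty family gives M: this is
   the convention for M = 1. For M <> 1 the family is never empty and its
   members lie in M, so intersecting with M changes nothing. *)
Definition fundament (H : profiniteGroupType) (M : set H) : set H :=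
  M `&` \bigcap_(N in maximal_normal M) N.

Definition fundament_kernel (H G : profiniteGroupType) (p : H -> G) : set H :=
  fundament (kernel p).

Definition fundamental (H G : profiniteGroupType) (p : H -> G) : Prop :=
  fundament_kernel p = [set 1].

Fixpoint fundament_series (H G : profiniteGroupType) (p : H -> G) (i : nat) :
    set H :=
  if i is j.+1 then fundament (fundament_series p j) else kernel p.

(* The square   P --eta--> Q
                |          |
               beta       phi
                v          v
                B -alpha-> A   (all four maps epimorphisms). *)
Definition semi_cartesian (P Q B A : profiniteGroupType)
    (eta : P -> Q) (beta : P -> B) (alpha : B -> A) (phi : Q -> A) : Prop :=
  alpha \o beta =1 phi \o eta /\ eta @` kernel beta = kernel phi.

(* [pi i] is the map G_(i+1) -> G_i, that is, pi_(i+1) in the usual indexing.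
   [transition pi k m] is the composite G_(m+k) -> G_k. *)
Fixpoint transition (G : nat -> profiniteGroupType)
    (pi : forall i, G i.+1 -> G i) (k m : nat) : G (m + k)%N -> G k :=
  match m return G (m + k)%N -> G k with
  | 0 => id
  | m'.+1 => fun x => transition pi (pi (m' + k)%N x)
  end.

(* H, with the maps rho, is the inverse limit: rho identifies H with the set of
   compatible sequences. As H is compact and each G_i is Hausdorff, continuity
   of the rho_i then makes this bijection a homeomorphism, so the topology of H
   needs no separate clause. *)
Definition is_inverse_limit (G : nat -> profiniteGroupType)
    (pi : forall i, G i.+1 -> G i)
    (H : profiniteGroupType) (rho : forall i, H -> G i) : Prop :=
  [/\ forall i, homomorphism (rho i),
      forall i, rho i =1 pi i \o rho i.+1
    & forall x : (forall i, G i), (forall i, pi i (x i.+1) = x i) ->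
        exists! h : H, forall i, rho i h = x i].

(* Main.v *)
From HB Require Import structures.
Require Import Defs.
From mathcomp Require Import all_boot.
From mathcomp Require Import boolp classical_sets functions topology.

(** Write R_k for the kernel of [rho k], a decreasing sequence of closed normal
    subgroups of H with trivial intersection.

    Epimorphisms out of H are determined up to isomorphism by their kernels, so
    the four conditions can be read off from normal subgroups of H.  An
    indecomposable eta through which [rho k] factors amounts to a maximal normal
    subgroup N of H inside R_k ([indecomposable_maximal]).  The square
    it forms with [rho l] is semi-cartesian iff R_l N = R_k, and by maximality
    this fails only if R_l lies in N ([maximal_normal_mul]).  Since [pi k] is
    fundamental, the fundament of R_k always lies in R_(k+1)
    ([fundament_preimage]).  So (d) says that R_(k+1) lies in every maximal N
    inside R_k, for all k; this is (a).  Replacing R_(k+1) by the smaller R_l in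
    the square only makes it harder to be semi-cartesian, which gives (b), and
    (c) is the special case of squares whose top map factors through [rho k.+2].

    What remains is to recover (d) from (c).  Let N be maximal inside R_k
    without containing R_(k+1).  If no R_j were inside N, then R_j N = R_k
    for all j, and compactness would give R_k = N, as the R_j shrink to 1
    ([maximal_normal_absorbs_tail]).  So there is a last l >= k with
    R_(l+1) not inside N, and R_(l+2) is inside N.  The modular law shows that
    N meets R_l in a maximal normal subgroup of H inside R_l ([setI_maximal]);
    modulo it one gets a square forbidden by (c) at level l
    ([maximal_normal_square]).

    All of this uses quotients of profinite groups by closed normal subgroups
    ([exists_quotient]).  That such a quotient is again totally disconnected
    rests on open subgroups forming a basis of neighbourhoods of 1, and that in
    turn on points of a compact totally disconnected Hausdorff space being
    separated by clopen sets. *)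

Set Implicit Arguments.
Unset Strict Implicit.
Unset Printing Implicit Defensive.

Local Open Scope classical_set_scope.
Local Open Scope group_scope.

(** * Clopen sets in compact spaces *)

(** The quasi-component of x is a filtered intersection of clopen sets, so by
    compactness one of these already fits into any given open neighbourhood of
    the quasi-component. *)
Lemma clopen_shrink (T : topologicalType) (x : T) (W : set T) :
  compact [set: T] -> open W ->
  (forall z, (forall D, clopen D -> D x -> D z) -> W z) ->
  exists D, [/\ clopen D, D x & D `<=` W].
Proof.
move=> cT oW QW.
pose F := filter_from [set D : set T | clopen D /\ D x] (fun D => D `\` W).
have FF : Filter F.
  apply: filter_from_filter; first by exists setT; split=> //; exact: clopenT.
  move=> A B [cA Ax] [cB Bx]; exists (A `&` B); first by split=> //; exact: clopenI.
  by move=> z [[? ?] ?].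
apply: contrapT => noD.
have PF : ProperFilter F.
  apply: filter_from_proper => D [cD Dx]; apply: contrapT => D0.
  apply: noD; exists D; split=> // z Dz; apply: contrapT => nWz.
  by apply: D0; exists z.
have [z [_ clz]] := cT F PF filterT.
have inD D C : clopen D -> D x -> closed C -> D `\` W `<=` C -> C z.
  move=> cD Dx cC sC; apply: cC => B Bz; apply: clz => //.
  by exists D.
have : (~` W) z.
  by apply: (inD setT) => [|||? []//] //; [exact: clopenT|exact: open_closedC].
by apply; apply: QW => D cD Dx; apply: (inD D) => //; case: cD.
Qed.

(** A separation of the quasi-component Q extends, by normality, to disjoint open
    sets covering Q, and then to a clopen D containing Q that they split into two
    clopen pieces.  The piece that contains x contains all of Q. *)
Lemma quasi_component_connected (T : topologicalType) (x : T) :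
  hausdorff_space T -> compact [set: T] ->
  connected [set z : T | forall D, clopen D -> D x -> D z].
Proof.
move=> hT cT; set Q := [set z | _].
have Qcl : closed Q.
  move=> z clz D cD Dx; case: (cD) => _; apply => B Bz.
  by have [t [Qt Bt]] := clz B Bz; exists t; split=> //; exact: Qt.
have Qx : Q x by move=> D.
apply/connectedP => E [E0 QE [s0 s1]].
wlog Ex : E E0 QE s0 s1 / E false x.
  move=> wl; have : (E false `|` E true) x by rewrite -QE.
  case=> Ex; first exact: (wl E).
  by apply: (wl (E \o negb)) => [[]||||] //=; rewrite ?QE 1?setUC 1?setIC.
have clE b : closed (E b).
  move=> z clz; have Qz : Q z.
    by apply: Qcl => B /clz [t [Et Bt]]; exists t; split=> //; rewrite QE;
      case: b Et {clz}; [right|left].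
  have : (E false `|` E true) z by rewrite -QE.
  by case: b clz => clz [] // Ez; exfalso; [move: s1|move: s0];
    apply/eqP/set0P; exists z.
have : set_nbhs (E false) (~` E true).
  apply/set_nbhsP; exists (~` E true); split=> //; first exact/closed_openC.
  by move=> z Ez Ez'; move: s0; apply/eqP/set0P; exists z; split=> //;
    exact: subset_closure.
case/(compact_normal hT cT (clE false)) => C /set_nbhsP [U [oU EU UC]] CE.
pose V := ~` closure C.
have oV : open V by exact/closed_openC/closed_closure.
have [|D [cD Dx DUV]] := @clopen_shrink T x (U `|` V) cT (openU oU oV).
  move=> z zQ; have : Q z by exact: zQ.
  by rewrite QE => -[/EU|Ez]; [left|right => /CE; exact].
have [z Ez] := E0 true.
have Qz : Q z by rewrite QE; right.
have cDU : clopen (D `&` U).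
  case: cD => oD clD; split; first exact: openI.
  (* On D the set U is the complement of V, hence closed. *)
  have -> : D `&` U = D `&` ~` V.
    apply/seteqP; split=> t [Dt Ut]; split=> //.
      by apply; apply: subset_closure; exact: UC.
    by case: (DUV _ Dt).
  by apply: closedI => //; exact: open_closedC.
have [_ Uz] := Qz _ cDU (conj Dx (EU _ Ex)).
by apply: (CE z) => //; apply: subset_closure; exact: UC.
Qed.

Lemma totally_disconnected_zero_dimensional (T : topologicalType) :
  hausdorff_space T -> compact [set: T] -> totally_disconnected [set: T] ->
  zero_dimensional T.
Proof.
move=> hT cT tT x y xy; apply: contrapT => nD.
have : connected_component [set: T] x y.
  exists [set z : T | forall D, clopen D -> D x -> D z].
    by split; [by []|by []|exact: quasi_component_connected].
  move=> D cD Dx; apply: contrapT => nDy; apply: nD; by exists D.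
by rewrite tT// => /= yx; rewrite yx eqxx in xy.
Qed.

Lemma zero_dimensional_hausdorff (T : topologicalType) :
  zero_dimensional T -> hausdorff_space T.
Proof.
move=> zT p q pq; apply: contrapT => /eqP/zT [U [[oU cU] Up Uq]].
have nU : nbhs p U by exact: open_nbhs_nbhs.
have nCU : nbhs q (~` U).
  by apply: open_nbhs_nbhs; split=> //; exact: closed_openC.
by have [z []] := pq _ _ nU nCU.
Qed.

(** * Open subgroups *)

Section TopologicalGroupTheory.
Variable A : topologicalGroupType.
Implicit Types (x y : A) (U V : set A).

Lemma mulg_nbhs x y V : nbhs (x * y) V ->
  exists U1 U2, [/\ nbhs x U1, nbhs y U2 &
    forall u v, U1 u -> U2 v -> V (u * v)].
Proof.
move=> /(@mulg_continuous A (x, y)) [[U1 U2] [/= U1x U2y] sU].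
by exists U1, U2; split=> // u v Uu Uv; exact: (sU (u, v)).
Qed.

Lemma mulgl_continuous x : continuous (fun y => x * y).
Proof.
move=> y V /mulg_nbhs [U1 [U2 [U1x U2y sV]]]; apply: filterS U2y => z.
by apply: sV; exact: nbhs_singleton.
Qed.

Lemma mulgr_continuous y : continuous (fun x => x * y).
Proof.
move=> x V /mulg_nbhs [U1 [U2 [U1x U2y sV]]]; apply: filterS U1x => z.
by move=> /sV; apply; exact: nbhs_singleton.
Qed.

Definition open_subgroup U :=
  [/\ open U, U 1, forall x y, U x -> U y -> U (x * y)
    & forall x, U x -> U x^-1].

(** The complement of an open subgroup is a union of cosets, which are open. *)
Lemma open_subgroup_clopen U : open_subgroup U -> clopen U.
Proof.
move=> [oU U1 UM UV]; split=> //; rewrite -openC.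
have -> : ~` U = \bigcup_(x in ~` U) [set y | U (x^-1 * y)].
  apply/seteqP; split=> [x Ux|y [x Ux Uxy] Uy]; first by exists x; rewrite //= mulVg.
  apply: Ux; rewrite -[x](mulVKg y) -[y^-1 * x]invgK invgM invgK.
  exact/UM/UV.
apply: bigcup_open => x _; have /continuousP := @mulgl_continuous x^-1.
by move/(_ _ oU).
Qed.

End TopologicalGroupTheory.

Lemma profinite_zero_dimensional (A : profiniteGroupType) : zero_dimensional A.
Proof.
apply: totally_disconnected_zero_dimensional.
- exact: profinite_hausdorff.
- exact: profinite_compact.
- exact: profinite_totally_disconnected.
Qed.

(** Take a clopen W inside V that contains 1.  The elements u such that W is
    stable under right translation by u and its inverse form a subgroup inside
    W, and by the tube lemma for the compact W it is a neighbourhood of 1. *)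
Lemma open_subgroup_nbhs (A : profiniteGroupType) (V : set A) :
  nbhs 1 V -> exists2 U, open_subgroup U & U `<=` V.
Proof.
move=> V1.
have [W [W1 [oW cW]] sWV] := zero_dimensional_cvg (@profinite_hausdorff A)
  (@profinite_zero_dimensional A) (@profinite_compact A) V1.
pose U := [set u : A | forall w, W w -> W (w * u) /\ W (w * u^-1)].
have nbU : nbhs 1 U.
  have /compact_near_coveringP cvW : compact W.
    exact: (subclosed_compact cW (@profinite_compact A)).
  apply: (cvW A (nbhs 1) (fun u w => W (w * u) /\ W (w * u^-1))) => w Ww.
  have nw : nbhs (w * 1) W by rewrite mulg1; exact: open_nbhs_nbhs.
  have [U1 [U2 [nU1 nU2 sW]]] := mulg_nbhs nw.
  have nU2' : nbhs 1 [set u : A | U2 u^-1].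
    by apply: (@invg_continuous A 1); rewrite invg1.
  exists (U1, U2 `&` [set u | U2 u^-1]) => [|[a b] /= [Ua [Ub Ub']]].
    by split=> //; exact: filterI.
  by split; exact: sW.
have UM x y : U x -> U y -> U (x * y).
  move=> Ux Uy w Ww; rewrite invgM !mulgA; split.
    by have [/Uy[]] := Ux w Ww.
  by have [_ /Ux[]] := Uy w Ww.
exists U; last by move=> u /(_ _ W1)[]; rewrite mul1g => /sWV.
split=> //; last by move=> u Uu w /Uu []; rewrite invgK.
  rewrite openE => u Uu.
  have nu : nbhs u [set v | U (u^-1 * v)].
    by apply: (@mulgl_continuous A u^-1); rewrite mulVg.
  suff : nbhs u U by [].
  apply: filterS nu => v /= Uuv.
  by rewrite -(mulVKg u v); exact: UM.
by move=> w; rewrite invg1 mulg1.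
Qed.

(** * Quotients of profinite groups *)

Definition coset_rel (A : profiniteGroupType) (N : set A) : rel A :=
  fun x y => `[< N (x^-1 * y) >].

Section Quotient.
Variables (A : profiniteGroupType) (N : set A) (nN : normal_subgroup N).

Lemma coset_rel_refl : reflexive (coset_rel N).
Proof. by move=> x; apply/asboolP; rewrite mulVg; case: nN. Qed.

Lemma coset_rel_sym : symmetric (coset_rel N).
Proof.
have sN x y : coset_rel N x y -> coset_rel N y x.
  move=> /asboolP Nxy; apply/asboolP.
  by rewrite -[_ * _]invgK invgM invgK; exact: (normalV nN).
by move=> x y; apply/idP/idP => /sN.
Qed.

Lemma coset_rel_trans : transitive (coset_rel N).
Proof.
move=> y x z /asboolP Nxy /asboolP Nyz; apply/asboolP.
by rewrite -(mulVKg y z) mulgA; exact: (normalM nN).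
Qed.

Canonical coset_equiv : equiv_rel A :=
  EquivRel (coset_rel N) coset_rel_refl coset_rel_sym coset_rel_trans.

Local Open Scope quotient_scope.

Definition quotient_group : Type := quotient_topology {eq_quot coset_equiv}.

HB.instance Definition _ := Topological.on quotient_group.
HB.instance Definition _ := Quotient.on quotient_group.

Definition quotient_proj : A -> quotient_group := \pi_quotient_group.
Local Notation q := quotient_proj.

Lemma quotient_proj_eq x y : (q x = q y) <-> N (x^-1 * y).
Proof.
split; first by move=> /eqquotP/asboolP.
by move=> Nxy; apply/eqquotP/asboolP.
Qed.

Lemma quotient_projP (u : quotient_group) : exists x, q x = u.
Proof. by exists (repr u); exact: reprK. Qed.

Definition quotient_mul (u v : quotient_group) := q (repr u * repr v).
Definition quotient_one := q 1.
Definition quotient_inv (u : quotient_group) := q (repr u)^-1.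

Lemma quotient_mulE x y : quotient_mul (q x) (q y) = q (x * y).
Proof.
apply/esym/quotient_proj_eq.
have Nx : N (x^-1 * repr (q x)) by apply/quotient_proj_eq; rewrite /q reprK.
have Ny : N (y^-1 * repr (q y)) by apply/quotient_proj_eq; rewrite /q reprK.
have -> : (x * y)^-1 * (repr (q x) * repr (q y)) =
    (x^-1 * repr (q x)) ^ y * (y^-1 * repr (q y)).
  by rewrite conjgE invgM !mulgA mulgK.
by apply: (normalM nN) => //; exact: (normalJ nN).
Qed.

Lemma quotient_invE x : quotient_inv (q x) = q x^-1.
Proof.
apply/quotient_proj_eq; rewrite invgK.
have Nx : N (x^-1 * repr (q x)) by apply/quotient_proj_eq; rewrite /q reprK.
have -> : repr (q x) * x^-1 = (x^-1 * repr (q x)) ^ x^-1.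
  by rewrite conjgE invgK !mulgA mulgV mul1g.
exact: (normalJ nN).
Qed.

Lemma quotient_mulA : associative quotient_mul.
Proof.
move=> u v w; have [[x <-] [y <-] [z <-]] :=
  And3 (quotient_projP u) (quotient_projP v) (quotient_projP w).
by rewrite !quotient_mulE mulgA.
Qed.

Lemma quotient_mul1 : left_id quotient_one quotient_mul.
Proof. by move=> u; have [x <-] := quotient_projP u; rewrite quotient_mulE mul1g. Qed.

Lemma quotient_mulr1 : right_id quotient_one quotient_mul.
Proof. by move=> u; have [x <-] := quotient_projP u; rewrite quotient_mulE mulg1. Qed.

Lemma quotient_mulV : left_inverse quotient_one quotient_inv quotient_mul.
Proof.
move=> u; have [x <-] := quotient_projP u.
by rewrite quotient_invE quotient_mulE mulVg.
Qed.

Lemma quotient_mulrV : right_inverse quotient_one quotient_inv quotient_mul.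
Proof.
move=> u; have [x <-] := quotient_projP u.
by rewrite quotient_invE quotient_mulE mulgV.
Qed.

HB.instance Definition _ := isGroup.Build quotient_group
  quotient_mulA quotient_mul1 quotient_mulr1 quotient_mulV quotient_mulrV.

Lemma quotient_proj_continuous : continuous q.
Proof. exact: pi_continuous. Qed.

Lemma quotient_proj_open (U : set A) : open U -> open (q @` U).
Proof.
move=> oU; suff : open (q @^-1` (q @` U)) by [].
have -> : q @^-1` (q @` U) = \bigcup_(n in N) [set x | U (x * n)].
  apply/seteqP; split=> [x [y Uy /esym/quotient_proj_eq Nxy]|x [n Nn Uxn]].
    by exists (x^-1 * y); rewrite //= mulVKg.
  exists (x * n) => //; apply/esym/quotient_proj_eq.
  by rewrite mulKg.
apply: bigcup_open => n _; have /continuousP := @mulgr_continuous A n.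
by move/(_ _ oU).
Qed.

(** The projection is open, so neighbourhoods of points upstairs map to
    neighbourhoods, and continuity can be tested on representatives in both
    factors at once. *)
Lemma quotient_mul_continuous :
  continuous (fun u : quotient_group * quotient_group => u.1 * u.2).
Proof.
move=> [u v]; have [[x <-] [y <-]] := conj (quotient_projP u) (quotient_projP v).
move=> /= V; rewrite [q x * q y]quotient_mulE => /quotient_proj_continuous.
move=> /mulg_nbhs [U1 [U2 [U1x U2y sV]]].
have nq (z : A) (U : set A) : nbhs z U -> nbhs (q z) (q @` U).
  rewrite nbhsE => -[O [oO Oz] sOU].
  suff : nbhs (q z) (q @` O) by apply: filterS => _ [t Ot <-]; exists t => //; exact: sOU.
  by apply: open_nbhs_nbhs; split; [exact: quotient_proj_open|exists z].
exists (q @` U1, q @` U2); first by split; exact: nq.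
move=> [_ _] /= [[a U1a <-] [b U2b <-]].
by rewrite [q a * q b]quotient_mulE; exact: sV.
Qed.

Lemma quotient_inv_continuous : continuous (fun u : quotient_group => u^-1).
Proof.
apply/quotient_continuous.
have -> : (fun u : quotient_group => u^-1) \o \pi_quotient_group =
    q \o (fun x : A => x^-1) by apply/funext => z; exact: quotient_invE.
move=> x; apply: continuous_comp; first exact: invg_continuous.
exact: quotient_proj_continuous.
Qed.

HB.instance Definition _ := isTopologicalGroup.Build quotient_group
  quotient_mul_continuous quotient_inv_continuous.

Lemma quotient_compact : compact [set: quotient_group].
Proof.
have -> : [set: quotient_group] = q @` [set: A].
  by apply/seteqP; split=> // u _; have [x <-] := quotient_projP u; exists x.
apply: continuous_compact; last exact: profinite_compact.
by apply: continuous_subspaceT; exact: quotient_proj_continuous.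
Qed.

(** Distinct cosets are separated by a translate of the image of a small open
    subgroup.  Both the Hausdorff property and total disconnectedness of the
    quotient follow from this. *)
Lemma quotient_zero_dimensional : zero_dimensional quotient_group.
Proof.
move=> u v; have [[x <-] [y <-]] := conj (quotient_projP u) (quotient_projP v).
move=> /eqP xy.
(* U must satisfy: U x^-1 y misses N, so that q y is outside q x * q U. *)
have nN1 : nbhs (1 : A) [set z | ~ N (z * (x^-1 * y))].
  suff nN1 : nbhs (1 * (x^-1 * y)) (~` N) by exact: (mulgr_continuous nN1).
  rewrite mul1g; apply: open_nbhs_nbhs; split.
    exact/closed_openC/(normal_closed nN).
  by move=> Nxy; apply: xy; apply/quotient_proj_eq.
have [U [oU U1 UM UV] sU] := open_subgroup_nbhs nN1.
have [oqU cqU] : clopen (q @` U).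
  apply: open_subgroup_clopen; split.
  - exact: quotient_proj_open.
  - by exists 1.
  - move=> _ _ [a Ua <-] [b Ub <-]; exists (a * b); first exact: UM.
    by rewrite [RHS]quotient_mulE.
  - by move=> _ [a Ua <-]; exists a^-1; [exact: UV|rewrite [RHS]quotient_invE].
exists [set w | (q @` U) ((q x)^-1 * w)]; split.
- have /continuousP cl := @mulgl_continuous quotient_group (q x)^-1.
  have /continuous_closedP cc := @mulgl_continuous quotient_group (q x)^-1.
  by split; [exact: cl|exact: cc].
- by exists 1 => //=; rewrite mulVg.
- move=> [a Ua]; rewrite [(q x)^-1]quotient_invE [RHS]quotient_mulE.
  by move=> /quotient_proj_eq; apply: sU; exact: UV.
Qed.

HB.instance Definition _ := TopologicalGroup_isProfinite.Build quotient_group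
  quotient_compact (zero_dimensional_hausdorff quotient_zero_dimensional)
  (zero_dimension_totally_disconnected quotient_zero_dimensional).

End Quotient.

Lemma exists_quotient (A : profiniteGroupType) (N : set A) :
  normal_subgroup N ->
  exists (K : profiniteGroupType) (q : A -> K), epimorphism q /\ kernel q = N.
Proof.
move=> nN; exists (quotient_group nN), (quotient_proj nN); split.
  split; last by move=> u _; have [x <-] := quotient_projP u; exists x.
  split; first exact: quotient_proj_continuous.
  by move=> x y; rewrite [RHS]quotient_mulE.
apply/seteqP; split=> x.
  by move=> /esym/quotient_proj_eq; rewrite invg1 mul1g.
by move=> Nx; apply/esym/quotient_proj_eq; rewrite invg1 mul1g.
Qed.

(** * Epimorphisms and their kernels *)

Section Homomorphisms.
Variables (A B : profiniteGroupType) (f : A -> B).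
Hypothesis fH : homomorphism f.

Lemma hom1 : f 1 = 1.
Proof. by have [_ fM] := fH; apply: (mulgI (f 1)); rewrite -fM !mulg1. Qed.

Lemma homV x : f x^-1 = (f x)^-1.
Proof.
by have [_ fM] := fH; apply: (mulgI (f x)); rewrite -fM !mulgV hom1.
Qed.

Lemma homJ x y : f (x ^ y) = f x ^ f y.
Proof. by have [_ fM] := fH; rewrite !conjgE !fM homV. Qed.

Lemma hom_eqP x y : f x = f y <-> kernel f (x^-1 * y).
Proof.
have [_ fM] := fH; split=> [fxy|]; rewrite /kernel /= fM homV.
  by rewrite fxy mulVg.
by move=> fxy; apply: (mulgI (f x)^-1); rewrite fxy mulVg.
Qed.

Lemma closed_set1 (x : B) : closed [set x].
Proof.
apply: compact_closed; first exact: profinite_hausdorff.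
exact: compact_set1.
Qed.

Lemma preimage_normal (N : set B) :
  normal_subgroup N -> normal_subgroup (f @^-1` N).
Proof.
have [fc fM] := fH; move=> nN; split.
- by have /continuous_closedP := fc; apply; case: nN.
- by rewrite /= hom1; exact: (normal1 nN).
- by move=> x y Nx Ny; rewrite /= fM; exact: (normalM nN).
- by move=> x Nx; rewrite /= homV; exact: (normalV nN).
- by move=> x y Nx; rewrite /= homJ; exact: (normalJ nN).
Qed.

Lemma trivial_normal : normal_subgroup [set (1 : B)].
Proof.
split=> //; first exact: closed_set1.
- by move=> x y /= -> ->; rewrite mulg1.
- by move=> x /= ->; rewrite invg1.
- by move=> x y /= ->; rewrite conj1g.
Qed.

Lemma kernel_normal : normal_subgroup (kernel f).
Proof. exact: preimage_normal trivial_normal. Qed.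

Lemma image_closed (C : set A) : closed C -> closed (f @` C).
Proof.
have [fc _] := fH; move=> cC.
apply: compact_closed; first exact: profinite_hausdorff.
apply: continuous_compact; first exact: continuous_subspaceT.
by apply: (subclosed_compact cC); first exact: profinite_compact.
Qed.

End Homomorphisms.

Lemma comp_hom (A B C : profiniteGroupType) (f : A -> B) (g : B -> C) :
  homomorphism f -> homomorphism g -> homomorphism (g \o f).
Proof.
move=> [fc fM] [gc gM]; split=> [x|x y]; last by rewrite /= fM gM.
by apply: continuous_comp; [exact: fc|exact: gc].
Qed.

Lemma comp_epi (A B C : profiniteGroupType) (f : A -> B) (g : B -> C) :
  epimorphism f -> epimorphism g -> epimorphism (g \o f).
Proof.
move=> [fH fS] [gH gS]; split; first exact: comp_hom.
by move=> z /gS [y /fS [x _ <-] <-]; exists x.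
Qed.

Lemma epiP (A B : profiniteGroupType) (f : A -> B) :
  epimorphism f -> forall y, exists x, f x = y.
Proof. by move=> [_ fS] y; have [x _ <-] := fS y I; exists x. Qed.

Lemma image_normal (A B : profiniteGroupType) (f : A -> B) (N : set A) :
  epimorphism f -> normal_subgroup N -> normal_subgroup (f @` N).
Proof.
move=> fE nN; have [fH fS] := fE; have [_ fM] := fH; split.
- by apply: image_closed => //; case: nN.
- by exists 1; [exact: (normal1 nN)|exact: hom1].
- by move=> _ _ [x Nx <-] [y Ny <-]; exists (x * y) => //; exact: (normalM nN).
- by move=> _ [x Nx <-]; exists x^-1; [exact: (normalV nN)|exact: homV].
- move=> _ z [x Nx <-]; have [y <-] := epiP fE z.
  by exists (x ^ y); [exact: (normalJ nN)|exact: homJ].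
Qed.

(** Continuity of the induced map comes from compactness: the preimage of a
    closed set is the image under q of a closed set, and q is a closed map. *)
Lemma epi_factor (A B C : profiniteGroupType) (q : A -> B) (f : A -> C) :
  epimorphism q -> homomorphism f -> kernel q `<=` kernel f ->
  exists2 h : B -> C, homomorphism h & f =1 h \o q.
Proof.
move=> qE fH sqf; have [qH _] := qE.
have [s sK] : exists s : B -> A, cancel s q.
  have [s sK] := choice (epiP qE); by exists s.
have fE x : f (s (q x)) = f x.
  by apply/(hom_eqP fH)/sqf/(hom_eqP qH); rewrite sK.
exists (f \o s) => [|x]; last by rewrite /= fE.
have [[fc fM] [_ qM]] := (fH, qH).
split.
  apply/continuous_closedP => D cD.
  suff -> : (f \o s) @^-1` D = q @` (f @^-1` D).
    by apply: image_closed => //; move/continuous_closedP: fc; exact.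
  apply/seteqP; split=> [y Dy|_ [x Dx <-]] /=; last by rewrite fE.
  by exists (s y).
move=> y z; have [[a <-] [b <-]] := conj (epiP qE y) (epiP qE z).
by rewrite -qM /= !fE fM.
Qed.

Lemma epi_factor_epi (A B C : profiniteGroupType) (q : A -> B) (f : A -> C) :
  epimorphism q -> epimorphism f -> kernel q `<=` kernel f ->
  exists2 h : B -> C, epimorphism h & f =1 h \o q.
Proof.
move=> qE fE sqf; have [h hH fhq] := epi_factor qE fE.1 sqf.
exists h => //; split=> // z _; have [x <-] := epiP fE z.
by exists (q x) => //; rewrite fhq.
Qed.

Lemma isomorphism_kernel (A B : profiniteGroupType) (f : A -> B) :
  epimorphism f -> (isomorphism f <-> kernel f `<=` [set 1]).
Proof.
move=> fE; split=> [[fH [g [_ gK _]]] x /= fx|f1].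
  by rewrite -(gK x) (fx : f x = 1) -(hom1 fH) gK.
have idH : homomorphism (@id A) by split=> // x; exact: cvg_id.
have [g gH gK] := epi_factor fE idH f1.
split; first by case: fE.
exists g; split; [by []|by move=> x; exact/esym/gK|move=> y].
by have [x <-] := epiP fE y; rewrite -[g (f x)]gK.
Qed.

Lemma kernel_comp (A B C : profiniteGroupType) (f : A -> B) (g : B -> C) :
  epimorphism f -> kernel (g \o f) `<=` kernel f -> kernel g `<=` [set 1].
Proof.
by move=> fE s y; have [x <-] := epiP fE y => /s.
Qed.

(** Factorizations of eta into two epimorphisms correspond to the normal subgroups
    of A between the kernels of q and of [eta \o q]. *)
Lemma indecomposable_maximal (A K B : profiniteGroupType)
    (q : A -> K) (eta : K -> B) :
  epimorphism q -> epimorphism eta ->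
  indecomposable eta <-> maximal_normal (kernel (eta \o q)) (kernel q).
Proof.
move=> qE eE; have [[qH _] [eH _]] := (qE, eE).
have sub (C : profiniteGroupType) (g : K -> C) :
    homomorphism g -> kernel q `<=` kernel (g \o q).
  by move=> gH x qx; rewrite /kernel /= (qx : q x = 1) hom1.
split=> [[niso ndec]|[_ [_ ne] max]].
  split; first exact: kernel_normal.
    split; first exact: sub.
    by move=> /(kernel_comp qE)/(isomorphism_kernel eE).
  move=> N nN [sN neN] sqN.
  have [C [r [rE rN]]] := exists_quotient nN.
  have [g gE rg] : exists2 g : K -> C, epimorphism g & r =1 g \o q.
    by apply: epi_factor_epi => //; rewrite rN.
  have [h hE eh] : exists2 h : C -> B, epimorphism h & eta \o q =1 h \o r.
    by apply: epi_factor_epi => //; [exact: comp_epi|rewrite rN].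
  apply: contrapT => NN; apply: ndec; exists C, g, h; split=> //.
  - move=> /(isomorphism_kernel gE) g1; apply: NN; apply/seteqP; split=> //.
    by rewrite -rN => x rx; apply: g1; rewrite /kernel /= -[g _]rg.
  - move=> /(isomorphism_kernel hE) h1; apply: neN; rewrite -rN => x ex.
    by apply: h1; rewrite /kernel /= -[h _]eh.
  - by move=> y; have [x <-] := epiP qE y; rewrite /= -[g _]rg -[RHS]eh.
split.
  move=> /(isomorphism_kernel eE) e1; apply: ne => x ex.
  exact: (e1 (q x)).
move=> [C [g [h [gE hE ng nh eq_hg]]]].
have nN : normal_subgroup (kernel (g \o q)).
  by apply: kernel_normal; apply: comp_hom => //; case: gE.
have sN : kernel (g \o q) `<=` kernel (eta \o q).
  move=> x gx; rewrite /kernel /= eq_hg /= (gx : g (q x) = 1).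
  by apply: hom1; case: hE.
apply: ng; apply/(isomorphism_kernel gE)/(kernel_comp qE).
rewrite (max _ nN) //; last by apply: sub; case: gE.
split=> // sN'; apply: nh; apply/(isomorphism_kernel hE).
apply: (kernel_comp (comp_epi qE gE)) => x hx; apply: sN'.
by rewrite /kernel /= eq_hg.
Qed.

(** * Maximal normal subgroups *)

Lemma preimage_maximal (A B : profiniteGroupType) (f : A -> B) (M N : set B) :
  epimorphism f -> maximal_normal M N ->
  maximal_normal (f @^-1` M) (f @^-1` N).
Proof.
move=> fE [nN [sNM neNM] max]; have [fH _] := fE.
split; first exact: preimage_normal.
  split=> [x /sNM //|s]; apply: neNM => y My.
  by have [x fx] := epiP fE y; rewrite -fx; apply: s; rewrite /= fx.
move=> L nL [sL neL] NL.
(* L contains the kernel of f, so it is saturated. *)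
have LE : L = f @^-1` (f @` L).
  apply/seteqP; split=> [x Lx|x [y Ly /(hom_eqP fH) kxy]]; first by exists x.
  rewrite -(mulVKg y x); apply: (normalM nL) => //; apply: NL.
  by rewrite /= (kxy : f _ = 1); exact: (normal1 nN).
rewrite LE; congr (f @^-1` _); apply: max; first exact: image_normal.
  split=> [_ [x Lx <-]|s]; first exact: sL.
  by apply: neL => x Mx; rewrite LE; exact: s.
by move=> y; have [x <-] := epiP fE y => /NL Lx; exists x.
Qed.

(** Maximal normal subgroups pull back to maximal normal subgroups.  The inclusion
    can be strict: those that do not contain the kernel of f are no preimages. *)
Lemma fundament_preimage (A B : profiniteGroupType) (f : A -> B) (M : set B) :
  epimorphism f -> fundament (f @^-1` M) `<=` f @^-1` (fundament M).
Proof.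
move=> fE x [Mx maxx]; split=> // N maxN.
exact: (maxx (f @^-1` N) (preimage_maximal fE maxN)).
Qed.

(** In terms of subgroups of A, with N the kernel of q: L N = M, since L N lies
    between N and M and differs from N. *)
Lemma maximal_normal_mul (A K : profiniteGroupType) (q : A -> K) (M L : set A) :
  epimorphism q -> maximal_normal M (kernel q) -> normal_subgroup M ->
  normal_subgroup L -> L `<=` M -> ~ L `<=` kernel q -> q @` L = q @` M.
Proof.
move=> qE [_ [sqM _] max] nM nL sLM nLq; have [qH _] := qE.
have nqL : normal_subgroup (q @^-1` (q @` L)).
  by apply: preimage_normal => //; exact: image_normal.
have sqL : q @^-1` (q @` L) `<=` M.
  move=> x [y Ly /(hom_eqP qH) kxy].
  by rewrite -(mulVKg y x); apply: (normalM nM); [exact: sLM|exact: sqM].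
apply/seteqP; split=> [|_ [x Mx <-]]; first exact: image_subset.
apply: contrapT => nx; apply: nLq => y Ly.
rewrite -(max _ nqL); [by exists y|split=> // s|].
  by apply: nx; exact: s.
by move=> z qz; exists 1; [exact: (normal1 nL)|rewrite hom1].
Qed.

Lemma setI_normal (A : profiniteGroupType) (M N : set A) :
  normal_subgroup M -> normal_subgroup N -> normal_subgroup (M `&` N).
Proof.
move=> [Mc M1 MM MV MJ] [Nc N1 NM NV NJ]; split=> //.
- exact: closedI.
- by move=> x y [? ?] [? ?]; split; [exact: MM|exact: NM].
- by move=> x [? ?]; split; [exact: MV|exact: NV].
- by move=> x y [? ?]; split; [exact: MJ|exact: NJ].
Qed.

(** The second isomorphism theorem: L / (N meet L) is isomorphic to the chief
    factor M / N, compatibly with the action of A.  The proof is the modular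
    law: if L' lies between N meet L and L and L' N = M, then L' = L. *)
Lemma setI_maximal (A : profiniteGroupType) (M N L : set A) :
  normal_subgroup M -> maximal_normal M N -> normal_subgroup L -> L `<=` M ->
  ~ L `<=` N -> maximal_normal L (N `&` L).
Proof.
move=> nM maxN nL sLM nLN; have [nN [sNM _] _] := maxN.
split; first exact: setI_normal.
  by split=> [x []//|s]; apply: nLN => x /s[].
move=> L' nL' [sL' neL'] sNL'; apply/seteqP; split=> // x L'x; split; last exact: sL'.
have [K [q [qE qN]]] := exists_quotient nN.
apply: contrapT => nNx; apply: neL' => y Ly.
have : (q @` L') (q y).
  rewrite (@maximal_normal_mul _ _ q M L') ?qN //; first by exists y => //; exact: sLM.
    by move=> z /sL' /sLM.
  by move=> /(_ _ L'x).
move=> [z L'z /(hom_eqP qE.1)]; rewrite qN => Nzy.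
rewrite -(mulVKg z y); apply: (normalM nL') => //; apply: sNL'; split=> //.
by apply: (normalM nL) => //; apply: (normalV nL); exact: sL'.
Qed.

(** By compactness, the nonempty closed sets cut out on the R n by the fibre of y
    have a common point. *)
Lemma bigcap_image (A K : profiniteGroupType) (q : A -> K) (R : nat -> set A) y :
  homomorphism q -> (forall n, closed (R n)) -> (forall n, R n.+1 `<=` R n) ->
  (forall n, (q @` R n) y) -> (q @` \bigcap_n R n) y.
Proof.
move=> [qc _] cR dR Ry.
have dRm m n : m <= n -> R n `<=` R m.
  move=> /subnK <-; elim: (n - m)%N => [//|k IH] x /dR /IH //.
pose F := filter_from [set: nat] (fun n => R n `&` q @^-1` [set y]).
have FF : ProperFilter F.
  apply: filter_from_proper; last by move=> n _; have [x Rx <-] := Ry n; exists x.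
  apply: filter_from_filter; first by exists 0.
  move=> m n _ _; exists (maxn m n) => // x [Rx qx].
  by split; split=> //; apply: dRm Rx; [exact: leq_maxl|exact: leq_maxr].
have [x [_ clx]] := @profinite_compact A F FF filterT.
have inC C n : closed C -> R n `&` q @^-1` [set y] `<=` C -> C x.
  by move=> cC sC; apply: cC => B Bx; apply: clx => //; exists n.
exists x; first by move=> n _; apply: (inC _ n) => // ? [].
apply: (inC (q @^-1` [set y]) 0) => [|? []//].
by have /continuous_closedP := qc; apply; exact: closed_set1.
Qed.

(** Starting at level 0 the sequence is built upwards by choosing preimages.  The
    general case shifts the inverse system by one and then applies [pi 0]; this
    induction keeps the dependent types of the levels in step. *)
Lemma compatible_lift (G : nat -> profiniteGroupType)
    (pi : forall i, G i.+1 -> G i) (k : nat) (g : G k) :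
  (forall i, epimorphism (pi i)) ->
  exists2 x : forall i, G i, (forall i, pi i (x i.+1) = x i) & x k = g.
Proof.
elim: k G pi g => [|k IH] G pi g piE.
  have /all_sig [s sP] : forall i, {s : G i -> G i.+1 | forall y, pi i (s y) = y}.
    by move=> i; apply: cid; have [s] := choice (epiP (piE i)); exists s.
  by exists (fix x i : G i := if i is j.+1 then s j (x j) else g) => // i; exact: sP.
have [x xP xk] := IH (fun i => G i.+1) (fun i => pi i.+1) g (fun i => piE i.+1).
by exists (fun i => if i is j.+1 then x j else pi 0 (x 0)) => //; case.
Qed.

(** * The inverse limit *)

Section InverseLimit.
Variables (G : nat -> profiniteGroupType) (pi : forall i, G i.+1 -> G i).
Hypothesis pi_epi : forall i, epimorphism (@pi i).
Variables (H : profiniteGroupType) (rho : forall i, H -> G i).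
Hypothesis H_lim : is_inverse_limit (@pi) rho.

Lemma rho_epi k : epimorphism (rho k).
Proof.
have [rhoH rhoE limH] := H_lim; split=> // g _.
have [x xP <-] := compatible_lift g pi_epi.
by have [h [hx _]] := limH x xP; exists h.
Qed.

Lemma kernel_rho_decr m n : m <= n -> kernel (rho n) `<=` kernel (rho m).
Proof.
have [rhoH rhoE limH] := H_lim.
move=> /subnK <-; elim: (n - m)%N => [//|k IH] x kx; apply: IH.
by rewrite /kernel /= rhoE /= (kx : rho _ x = 1) (hom1 (pi_epi _).1).
Qed.

Lemma bigcap_kernel_rho : \bigcap_n kernel (rho n) `<=` [set 1].
Proof.
have [rhoH rhoE limH] := H_lim => x kx.
have [h [_ uniq]] := limH (fun i => 1) (fun i => hom1 (pi_epi i).1).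
by rewrite /= -(uniq x) ?(uniq 1) // => i; [exact: hom1|exact: kx].
Qed.

(** If no R_j were inside N, every R_j would have the same image modulo N as R_k.
    Then so would their intersection, which is trivial. *)
Lemma maximal_normal_absorbs_tail k N :
  maximal_normal (kernel (rho k)) N -> exists j, kernel (rho j) `<=` N.
Proof.
move=> maxN; have [nN [_ neNR] _] := maxN.
have [rhoH _ _] := H_lim; have nR n := kernel_normal (rhoH n).
apply: contrapT => noj; apply: neNR => y Ry.
have [K [q [qE qN]]] := exists_quotient nN.
have : (q @` \bigcap_n kernel (rho n)) (q y).
  apply: bigcap_image; first by case: qE.
  - by move=> n; case: (nR n).
  - by move=> n; exact: kernel_rho_decr.
  move=> n; have : (q @` kernel (rho k)) (q y) by exists y.
  have <- : q @` kernel (rho (maxn n k)) = q @` kernel (rho k).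
    apply: maximal_normal_mul; rewrite ?qN //.
      exact/kernel_rho_decr/leq_maxr.
    by move=> s; apply: noj; exists (maxn n k).
  by move=> [x kx <-]; exists x => //; apply: kernel_rho_decr kx; exact: leq_maxl.
move=> [x /bigcap_kernel_rho /= -> qy].
by rewrite -qN /kernel /= -qy; exact: (hom1 qE.1).
Qed.

(** The group K is H / N.  As N contains the kernel of [rho l.+2], the projection
    to K factors through [G l.+2]. *)
Lemma maximal_normal_square l N :
  maximal_normal (kernel (rho l)) N -> kernel (rho l.+2) `<=` N ->
  ~ kernel (rho l.+1) `<=` N ->
  exists (K : profiniteGroupType) (tau : G l.+2 -> K) (eta : K -> G l),
    [/\ epimorphism tau, epimorphism eta, indecomposable eta
      & semi_cartesian tau (@pi l.+1) (@pi l) eta].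
Proof.
move=> maxN sRN nRN; have [nN [sNR _] _] := maxN.
have [rhoH rho_lim _] := H_lim; have nR n := kernel_normal (rhoH n).
have rhoE := rho_epi.
have pi_rho i x : pi (rho i.+1 x) = rho i x by exact/esym/rho_lim.
have [K [q [qE qN]]] := exists_quotient nN.
have [eta eE rho_eta] : exists2 eta : K -> G l,
    epimorphism eta & rho l =1 eta \o q.
  by apply: epi_factor_epi => //; rewrite qN.
have [tau tE q_tau] : exists2 tau : G l.+2 -> K,
    epimorphism tau & q =1 tau \o rho l.+2.
  by apply: epi_factor_epi => //; rewrite qN.
have kE : kernel (eta \o q) = kernel (rho l).
  by apply/seteqP; split=> y; rewrite /kernel /= rho_eta.
exists K, tau, eta; split=> //.
  by apply/(indecomposable_maximal qE eE); rewrite kE qN.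
split=> [y|].
  by have [x <-] := epiP (rhoE l.+2) y; rewrite /= !pi_rho rho_eta /= q_tau.
have qR : q @` kernel (rho l.+1) = q @` kernel (rho l).
  by apply: maximal_normal_mul => //; rewrite ?qN //; exact: kernel_rho_decr.
apply/seteqP; split=> [_ [y ky <-]|y].
  have [x xy] := epiP (rhoE l.+2) y.
  rewrite /kernel /= -xy -[tau _]q_tau -[eta _]rho_eta -pi_rho -pi_rho xy.
  by rewrite (ky : pi y = 1); exact: (hom1 (pi_epi l).1).
have [x <-] := epiP qE y => ex.
have : (q @` kernel (rho l)) (q x) by exists x => //; rewrite -kE.
rewrite -qR => -[z kz <-]; exists (rho l.+2 z); last by rewrite q_tau.
by rewrite /kernel /= pi_rho.
Qed.

End InverseLimit.

(** * The equivalence *)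

(* Indices are shifted: k stands for the index k - 1 of the groups G_(k-1) and
   H_(k-1) in (a)-(c), and m.+1 + k for l in (b). *)
Theorem proposition9p5
    (G : nat -> profiniteGroupType) (pi : forall i, G i.+1 -> G i)
    (pi_epi : forall i, epimorphism (pi i))
    (pi_fundamental : forall i, fundamental (pi i))
    (H : profiniteGroupType) (rho : forall i, H -> G i)
    (H_lim : is_inverse_limit pi rho) :
  [<->
    (forall k : nat,
      ~ exists (K : profiniteGroupType) (sigma : H -> K) (eta : K -> G k),
          [/\ epimorphism sigma, epimorphism eta, indecomposable eta,
              eta \o sigma =1 rho k
            & semi_cartesian sigma (rho k.+1) (pi k) eta]);
    (forall k m : nat,
      ~ exists (K : profiniteGroupType) (sigma : H -> K) (eta : K -> G k),
          [/\ epimorphism sigma, epimorphism eta, indecomposable eta,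
              eta \o sigma =1 rho k
            & semi_cartesian sigma (rho (m.+1 + k)%N)
                (@transition G pi k m.+1) eta]);
    (forall k : nat,
      ~ exists (K : profiniteGroupType) (tau : G k.+2 -> K) (eta : K -> G k),
          [/\ epimorphism tau, epimorphism eta, indecomposable eta
            & semi_cartesian tau (pi k.+1) (pi k) eta]);
    (forall k : nat, kernel (rho k) = fundament_series (rho 0) k)].
Proof.
have rhoE := rho_epi pi_epi H_lim.
have [rhoH rho_lim _] := H_lim.
have pi_rho i x : pi i (rho i.+1 x) = rho i x by exact/esym/rho_lim.
have decr := kernel_rho_decr pi_epi H_lim.
have nR k : normal_subgroup (kernel (rho k)) by exact: (kernel_normal (rhoH k)).
tfae.
- (* The smaller group R_(m+1+k) maps onto the kernel of eta, hence so does
     R_(k+1). *)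
  move=> a k m [K [sigma [eta [sE eE ind eq_rho [_ sc]]]]].
  apply: (a k); exists K, sigma, eta; split=> //; split=> [x|].
    by rewrite eq_rho /= pi_rho.
  apply/seteqP; split=> [_ [x kx <-]|y].
    by rewrite /kernel /= -[eta _]/((eta \o sigma) x) eq_rho; exact: (decr k k.+1).
  rewrite -sc => -[x kx <-]; exists x => //; apply: decr kx.
  by rewrite addSn ltnS leq_addl.
- (* Compose tau with [rho k.+2]; the transition map for m = 0 is [pi k]. *)
  move=> b k [K [tau [eta [tE eE ind [comm sc]]]]].
  apply: (b k 0); exists K, (tau \o rho k.+2), eta; split=> //.
  + exact: comp_epi.
  + by move=> x; rewrite /= -[eta _]comm /= !pi_rho.
  split=> [x|]; first by rewrite /= -[RHS]comm /= pi_rho.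
  rewrite -sc; apply/seteqP; split=> [_ [x kx <-]|_ [y ky <-]].
    by exists (rho k.+2 x) => //; rewrite /kernel /= pi_rho.
  have [x xy] := epiP (rhoE k.+2) y; exists x; last by rewrite /= xy.
  by rewrite /kernel /= -pi_rho xy.
- move=> c.
  have step k N : maximal_normal (kernel (rho k)) N -> kernel (rho k.+1) `<=` N.
    move=> maxN; apply: contrapT => nRN; have [nN _ _] := maxN.
    have [j0 Rj0] := maximal_normal_absorbs_tail pi_epi H_lim maxN.
    have exj : exists j, `[< kernel (rho j) `<=` N >] by exists j0; exact/asboolP.
    (* For the least j with R_j inside N, the level sought is l = j - 2. *)
    case: (ex_minnP exj) => j /asboolP RjN minj.
    have ltkj : k.+1 < j.
      by rewrite ltnNge; apply/negP => le; apply: nRN => x /(decr _ _ le) /RjN.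
    case: j RjN minj ltkj => [//|[//|l]] RlN minl lekl.
    have nRl1 : ~ kernel (rho l.+1) `<=` N.
      by move=> /asboolP /minl; rewrite ltnn.
    have nRl : ~ kernel (rho l) `<=` N.
      by move=> s; apply: nRl1 => x /(decr l l.+1 (leqnSn l)) /s.
    have maxl := setI_maximal (nR k) maxN (nR l) (decr k l lekl) nRl.
    apply: (c l); apply: (maximal_normal_square pi_epi H_lim maxl).
      by move=> x kx; split; [exact: RlN|exact: (decr l l.+2 (leqW (leqnSn l)))].
    by move=> s; apply: nRl1 => x /s [].
  elim=> [//|k IH] /=; rewrite -IH; apply/seteqP; split=> [x kx|x].
    by split=> [|N maxN]; [exact: (decr k k.+1)|exact: (step k)].
  have kE : kernel (rho k) = rho k.+1 @^-1` kernel (pi k).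
    by apply/seteqP; split=> y; rewrite /kernel /= pi_rho.
  rewrite {1}kE => /(fundament_preimage (rhoE k.+1)).
  by rewrite -[fundament _]/(fundament_kernel (pi k)) pi_fundamental.
- (* The kernel of sigma is maximal in R_k, so it contains the fundament R_(k+1)
     and sigma kills R_(k+1), whereas eta is not injective. *)
  move=> d k [K [sigma [eta [sE eE ind eq_rho [_ sc]]]]].
  have kE : kernel (eta \o sigma) = kernel (rho k).
    by apply/seteqP; split=> y; rewrite /kernel /= -[eta _]/((eta \o sigma) y) eq_rho.
  have maxs : maximal_normal (kernel (rho k)) (kernel sigma).
    by rewrite -kE; apply/(indecomposable_maximal sE eE).
  have sk : kernel (rho k.+1) `<=` kernel sigma.
    by rewrite d /= -d => x [_]; exact.
  have [_ [_ ne] _] := maxs; apply: ne => x; rewrite -kE => ex.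
  have : kernel eta (sigma x) by [].
  by rewrite -sc /kernel /= => -[y /sk sy <-].
Qed.
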